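(* A regular curve $\gamma(t)=(u(t),v(t))$ in $\mathbb{H}^2_+$ is a hyperbolic horo-catenary (with parameter $\lambda\in\mathbb{R}$) if and only if its curvature $\kappa_h$ satisfies $$\kappa_h=-\frac{uu'+vv'}{(d_{hor}+\lambda)\,v\sqrt m},$$ where $m=u'^2+v'^2$ and $d_{hor}=u/v$.
   Context: $\mathbb{H}^2$ is the upper half-plane $\{(x,y)\in\mathbb{R}^2:y>0\}$ with the metric $g=\frac{dx^2+dy^2}{y^2}$, and $\mathbb{H}^2_+=\{(x,y)\in\mathbb{H}^2:x>0\}$. The horocycle distance of $(x,y)\in\mathbb{H}^2_+$ to the geodesic $L=\{(0,y):y>0\}$ is $d_{hor}=x/y$ (length along the horizontal horocycle through $(x,y)$, which is orthogonal to $L$). Regular means $\gamma'(t)\neq0$ for all $t$. The potential energy of $\gamma=(u,v)$, $t\in[a,b]$, is $$\mathcal{E}^{hor}_H[\gamma]=\int_a^b\left(\frac{u}{v}+\lambda\right)\frac{\sqrt{u'^2+v'^2}}{v}\,dt,$$ where $\lambda\in\mathbb{R}$ is a constant (a Lagrange multiplier). A hyperbolic horo-catenary is a critical point of $\mathcal{E}^{hor}_H$ (for variations with fixed endpoints, among curves in $\mathbb{H}^2_+$), i.e. $(u,v)$ satisfies both Euler–Lagrange equations of the integrand. Sign convention: $\kappa_h$ is the geodesic curvature of $\gamma$ in $\mathbb{H}^2$ with respect to the unit normal $\mathbf{n}=v\frac{(-v',u')}{\sqrt m}$; explicitly $\kappa_h=v\,\frac{u'v''-u''v'}{m^{3/2}}+\frac{u'}{\sqrt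 m}$. *)

(* Defs.v *)
From Stdlib Require Import Reals Lra.
From Coquelicot Require Import Coquelicot.
Open Scope R_scope.

(** [f] is of class C^2 on the closed interval [[a, b]], in the usual sense that
    it is C^2 on some open interval containing it.  Each order of
    differentiability is required explicitly, because [Derive] is total and
    [ex_derive_n f 2] alone does not imply [ex_derive f]. *)
Definition C2_on (a b : R) (f : R -> R) : Prop :=
  exists eps : R, 0 < eps /\
    forall t : R, a - eps < t < b + eps ->
      ex_derive f t /\ ex_derive (Derive f) t /\ continuous (Derive (Derive f)) t.

Definition in_Hplus (p : R * R) : Prop := 0 < fst p /\ 0 < snd p.

Definition d_hor (p : R * R) : R := fst p / snd p.

(** Squared Euclidean speed [m = u'^2 + v'^2]. *)
Definition speed2 (u v : R -> R) (t : R) : R := Derive u t ^ 2 + Derive v t ^ 2.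

Definition regular_curve_in_Hplus (a b : R) (u v : R -> R) : Prop :=
  C2_on a b u /\ C2_on a b v /\
  forall t : R, a <= t <= b ->
    in_Hplus (u t, v t) /\ (Derive u t, Derive v t) <> (0, 0).

(** Geodesic curvature for the metric [(dx^2 + dy^2) / y^2] and the unit normal
    [v * (- v', u') / sqrt m]. *)
Definition kappa_h (u v : R -> R) (t : R) : R :=
  v t * ((Derive u t * Derive (Derive v) t - Derive (Derive u) t * Derive v t)
         / Rpower (speed2 u v t) (3 / 2))
  + Derive u t / sqrt (speed2 u v t).

Definition energy_hor (lambda a b : R) (u v : R -> R) : R :=
  RInt (fun t => (d_hor (u t, v t) + lambda) * (sqrt (speed2 u v t) / v t)) a b.

(** Critical point of the energy: the first variation vanishes along every
    variation [(u + s xi, v + s eta)] of class C^2 with fixed endpoints.  When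
    [(u, v)] is a regular curve in the open set [in_Hplus], so is the varied
    curve for all small [s], by compactness of [[a, b]]; hence no side condition
    is needed to keep the variation among the admissible curves. *)
Definition horo_catenary (lambda a b : R) (u v : R -> R) : Prop :=
  forall xi eta : R -> R,
    C2_on a b xi -> C2_on a b eta ->
    xi a = 0 -> xi b = 0 -> eta a = 0 -> eta b = 0 ->
    is_derive
      (fun s : R => energy_hor lambda a b
                      (fun t => u t + s * xi t) (fun t => v t + s * eta t))
      0 0.

(* Main.v *)
Require Import Defs.
From Stdlib Require Import Reals Lra.
From Coquelicot Require Import Coquelicot.
Open Scope R_scope.

(** Differentiating the energy under the integral sign and integrating by parts,
    the first variation is the integral of [G * (v' xi - u' eta)], where
    [v^3 sqrt m * G = N := (d_hor + lambda) v sqrt m kappa_h + (u u' + v v')].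
    By the fundamental lemma of the calculus of variations (tested on C^2 bumps)
    criticality means [N = 0] on [[a, b]], which is the asserted formula wherever
    [D := d_hor + lambda] is nonzero.

    Where [D t = 0] the right-hand side of the formula is [0], because [/ 0 = 0],
    so one must compare [N t = 0] with [kappa_h t = 0] there.
    If [N = 0] on [[a, b]], then [u u' + v v' = 0] at [t], so the velocity is
    orthogonal to the position vector and [D' t <> 0]; the equation [N' t = 0]
    then reads [2 D' v sqrt m kappa_h = 0].
    Conversely, if the formula holds and [N t <> 0], then [D] vanishes on an interval
    near [t], i.e. the curve runs along a Euclidean ray [u = - lambda v] from the
    origin; such a ray in [x > 0] has constant nonzero curvature, a contradiction. *)

(** * Pointwise regularity and stability of positivity *)

(** Extensionality goals for [is_derive] and [RInt] are equalities in the carrier of a module;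
    retyping them over [R] makes them visible to [ring]. *)
Ltac ring_R := intros; match goal with |- @eq _ ?x ?y => change (@eq R x y) end; ring.

Lemma C2_on_at (a b : R) (f : R -> R) (t : R) :
  C2_on a b f -> a <= t <= b ->
  ex_derive f t /\ ex_derive (Derive f) t /\ continuous (Derive (Derive f)) t.
Proof.
intros [e [He H]] Ht; apply H; lra.
Qed.

Lemma ex_derive_continuity_pt (f : R -> R) (t : R) : ex_derive f t -> continuity_pt f t.
Proof.
intros H; apply continuity_pt_filterlim; exact (ex_derive_continuous f t H).
Qed.

(** By compactness [|g| / f] attains a maximum [M] on [[a, b]], and [|s| < / (1 + M)] forces
    [|s * g t| < f t] for all [t] at once. The summand [1] keeps the radius finite when [M = 0]. *)
Lemma perturbation_pos (a b : R) (f g : R -> R) :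
  a <= b ->
  (forall t, a <= t <= b -> continuity_pt f t) ->
  (forall t, a <= t <= b -> continuity_pt g t) ->
  (forall t, a <= t <= b -> 0 < f t) ->
  locally 0 (fun s => forall t, a <= t <= b -> 0 < f t + s * g t).
Proof.
intros hab Cf Cg Pf.
destruct (continuity_ab_maj (fun t => Rabs (g t) * / f t) a b hab) as [x [Hx Ix]].
{ intros c Hc; apply continuity_pt_mult.
  - apply (continuity_pt_comp g Rabs); [apply Cg; lra | apply Rcontinuity_abs].
  - apply continuity_pt_inv; [apply Cf; lra | specialize (Pf c Hc); lra]. }
set (M := Rabs (g x) * / f x) in *.
assert (HM : 0 <= M).
{ apply Rmult_le_pos; [apply Rabs_pos | left; apply Rinv_0_lt_compat, Pf, Ix]. }
assert (Hd : 0 < / (1 + M)) by (apply Rinv_0_lt_compat; lra).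
exists (mkposreal _ Hd); intros s Hs t Ht.
change (Rabs (s - 0) < / (1 + M)) in Hs; rewrite Rminus_0_r in Hs.
specialize (Hx t Ht); simpl in Hx; specialize (Pf t Ht).
assert (Hg : Rabs (g t) <= M * f t).
{ replace (Rabs (g t)) with (Rabs (g t) * / f t * f t) by (field; lra).
  apply Rmult_le_compat_r; lra. }
assert (Hs1 : Rabs s * (1 + M) < 1).
{ replace 1 with (/ (1 + M) * (1 + M)) at 2 by (field; lra).
  apply Rmult_lt_compat_r; lra. }
assert (Hb : Rabs (s * g t) < f t).
{ rewrite Rabs_mult.
  assert (H0 := Rabs_pos s); assert (H1 := Rabs_pos (g t)).
  assert (Rabs s * Rabs (g t) <= Rabs s * (M * f t)) by (apply Rmult_le_compat_l; lra).
  assert (Rabs s * M * f t < 1 * f t); [|lra].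
  apply Rmult_lt_compat_r; lra. }
apply Rabs_def2 in Hb; lra.
Qed.

(** * One-variable derivatives and C^2 bump functions *)

(* [2 * max(x, 0)^3], which is of class C^2. *)
Definition cubic_part (x : R) : R := x ^ 2 * (x + Rabs x).

(** All difference quotients at [t] with [t + h] inside [[a, b]] are zero, and arbitrarily small
    such [h] exist even when [t] is an endpoint: to the right if [t < b], otherwise to the left. *)
Lemma is_derive_zero_on_interval (f : R -> R) (a b t l : R) :
  a < b -> a <= t <= b -> is_derive f t l ->
  (forall x, a <= x <= b -> f x = 0) -> l = 0.
Proof.
intros hab Ht Hd Hz.
apply is_derive_Reals in Hd.
destruct (Req_dec l 0) as [|Hl]; [assumption|exfalso].
destruct (Hd (Rabs l) (Rabs_pos_lt _ Hl)) as [d Hd'].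
assert (Hdp := cond_pos d).
assert (Hh : exists h, h <> 0 /\ Rabs h < d /\ a <= t + h <= b).
{ destruct (Rlt_dec t b) as [Hb|Hb].
  - exists (Rmin (d / 2) (b - t)).
    assert (0 < Rmin (d / 2) (b - t)) by (apply Rmin_pos; lra).
    assert (H1 := Rmin_l (d / 2) (b - t)); assert (H2 := Rmin_r (d / 2) (b - t)).
    rewrite Rabs_right; lra.
  - exists (- Rmin (d / 2) (t - a)).
    assert (0 < Rmin (d / 2) (t - a)) by (apply Rmin_pos; lra).
    assert (H1 := Rmin_l (d / 2) (t - a)); assert (H2 := Rmin_r (d / 2) (t - a)).
    rewrite Rabs_Ropp, Rabs_right; lra. }
destruct Hh as [h [h0 [hd hI]]].
specialize (Hd' h h0 hd).
rewrite (Hz (t + h)), (Hz t) in Hd' by lra.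
replace ((0 - 0) / h - l) with (- l) in Hd' by (field; assumption).
rewrite Rabs_Ropp in Hd'; lra.
Qed.

(** At a root of [f] the difference quotient of [f * g] is that of [f] times [g (t + h)], so [g]
    enters only through its limit at [t]. This serves for [Rabs] at [0] and for the curvature, which
    is merely continuous on a C^2 curve. *)
Lemma is_derive_mult_root (f g : R -> R) (t l : R) :
  is_derive f t l -> f t = 0 -> continuity_pt g t ->
  is_derive (fun x => f x * g x) t (l * g t).
Proof.
intros Hf Hz Hg.
apply is_derive_Reals; apply is_derive_Reals in Hf.
assert (Hq : limit1_in (fun h => (f (t + h) - f t) / h * g (t + h))
               (fun h => h <> 0) (l * g t) 0).
{ apply limit_mul.
  - intros e He; destruct (Hf e He) as [d Hd].
    exists d; split; [apply cond_pos|].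
    intros h [Hh1 Hh2]; simpl in *; unfold R_dist in *; rewrite Rminus_0_r in Hh2.
    apply Hd; assumption.
  - intros e He; destruct (Hg e He) as [d [Hd H]].
    exists d; split; [assumption|].
    intros h [Hh1 Hh2]; simpl in *; unfold R_dist in *; rewrite Rminus_0_r in Hh2.
    apply H; split; [split; [exact I | lra]|].
    replace (t + h - t) with h by ring; assumption. }
intros e He; destruct (Hq e He) as [d [Hd H]].
exists (mkposreal d Hd); intros h h0 hd.
specialize (H h); simpl in H; unfold R_dist in H.
rewrite Hz in *; rewrite Rmult_0_l.
replace ((f (t + h) * g (t + h) - 0) / h)
  with ((f (t + h) - 0) / h * g (t + h)) by (field; assumption).
apply H; rewrite Rminus_0_r; split; assumption.
Qed.

Lemma is_derive_mult_Rabs (x : R) : is_derive (fun x => x * Rabs x) x (2 * Rabs x).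
Proof.
destruct (Req_dec x 0) as [->|Hx].
- replace (2 * Rabs 0) with (1 * Rabs 0) by (rewrite Rabs_R0; ring).
  apply (is_derive_mult_root (fun x => x) Rabs);
    [apply (is_derive_id 0) | reflexivity | apply Rcontinuity_abs].
- auto_derive; [assumption|].
  assert (H : x * sign x = Rabs x).
  { destruct (Rlt_dec 0 x).
    - rewrite sign_eq_1, Rabs_right; lra.
    - rewrite sign_eq_m1, Rabs_left; lra. }
  lra.
Qed.

Lemma is_derive_cubic_part (x : R) :
  is_derive cubic_part x (3 * (x * (x + Rabs x))).
Proof.
unfold cubic_part.
(* [Rabs] is grouped into [x * Rabs x], which is differentiable everywhere, including at [0]. *)
apply (is_derive_ext (fun x => x ^ 3 + x * (x * Rabs x))); [ring_R|].
replace (3 * (x * (x + Rabs x))) with (3 * x ^ 2 + (1 * (x * Rabs x) + x * (2 * Rabs x))) by ring.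
apply (is_derive_plus (fun x => x ^ 3)); [auto_derive; [trivial|ring]|].
apply (is_derive_mult (fun x => x) (fun x => x * Rabs x));
  [apply (is_derive_id x) | apply is_derive_mult_Rabs | intros; apply Rmult_comm].
Qed.

Lemma is_derive_cubic_part_2 (x : R) :
  is_derive (fun x => 3 * (x * (x + Rabs x))) x (6 * (x + Rabs x)).
Proof.
apply (is_derive_ext (fun x => 3 * (x ^ 2 + x * Rabs x))); [ring_R|].
replace (6 * (x + Rabs x)) with (3 * (2 * x + 2 * Rabs x)) by ring.
apply (is_derive_scal (fun x => x ^ 2 + x * Rabs x)).
apply (is_derive_plus (fun x => x ^ 2)); [auto_derive; [trivial|ring]|].
apply is_derive_mult_Rabs.
Qed.


Lemma C2_on_intro (a b : R) (f f1 f2 : R -> R) :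
  (forall x, is_derive f x (f1 x)) -> (forall x, is_derive f1 x (f2 x)) ->
  (forall x, continuous f2 x) -> C2_on a b f.
Proof.
intros H1 H2 H3; exists 1; split; [lra|]; intros t _.
assert (E : forall x, Derive f x = f1 x) by (intros; apply is_derive_unique, H1).
assert (E2 : forall x, Derive (Derive f) x = f2 x).
{ intros x; rewrite (Derive_ext _ _ x E); apply is_derive_unique, H2. }
split; [eexists; apply H1|split].
- apply (ex_derive_ext f1); [intros; symmetry; apply E | eexists; apply H2].
- apply (continuous_ext f2); [intros; symmetry; apply E2 | apply H3].
Qed.

(** For [c < d], a C^2 function on the whole line that is positive exactly on the open interval from
    [c] to [d]. *)
Definition bump (c d t : R) : R := cubic_part (t - c) * cubic_part (d - t).

Lemma C2_on_bump (a b c d : R) : C2_on a b (bump c d).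
Proof.
set (P1 := fun x => 3 * (x * (x + Rabs x))).
set (P2 := fun x => 6 * (x + Rabs x)).
assert (D0 : forall x, is_derive cubic_part x (P1 x)) by (intros; apply is_derive_cubic_part).
assert (D1 : forall x, is_derive P1 x (P2 x)) by (intros; apply is_derive_cubic_part_2).
apply (C2_on_intro a b _
  (fun t => P1 (t - c) * cubic_part (d - t) - cubic_part (t - c) * P1 (d - t))
  (fun t => P2 (t - c) * cubic_part (d - t) - 2 * (P1 (t - c) * P1 (d - t))
            + cubic_part (t - c) * P2 (d - t))).
- intros t; unfold bump; auto_derive.
  + repeat split; eexists; apply D0.
  + rewrite !(is_derive_unique _ _ _ (D0 _)); unfold Rminus; ring.
- intros t; auto_derive.
  + repeat split; eexists; first [apply D0 | apply D1].
  + rewrite !(is_derive_unique _ _ _ (D0 _)), !(is_derive_unique _ _ _ (D1 _)); unfold Rminus; ring.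
- assert (L : continuity (fun x => x - c)) by reg.
  assert (M : continuity (fun x => d - x)) by reg.
  assert (C0 : continuity cubic_part).
  { intros x; apply ex_derive_continuity_pt; eexists; apply D0. }
  assert (C1 : continuity P1).
  { intros x; apply ex_derive_continuity_pt; eexists; apply D1. }
  assert (C2 : continuity P2).
  { unfold P2; intros x; apply continuity_pt_mult; [apply continuity_const; intros ? ?; reflexivity|].
    apply continuity_pt_plus; [apply derivable_continuous_pt, derivable_pt_id | apply Rcontinuity_abs]. }
  assert (CL : forall P, continuity P -> continuity (fun x => P (x - c))).
  { intros P HP; apply (continuity_comp _ P L HP). }
  assert (CM : forall P, continuity P -> continuity (fun x => P (d - x))).
  { intros P HP; apply (continuity_comp _ P M HP). }
  intros t; apply continuity_pt_filterlim; apply continuity_pt_plus; [apply continuity_pt_minus|].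
  + apply continuity_pt_mult; [apply CL, C2 | apply CM, C0].
  + apply continuity_pt_mult; [apply continuity_const; intros ? ?; reflexivity|].
    apply continuity_pt_mult; [apply CL, C1 | apply CM, C1].
  + apply continuity_pt_mult; [apply CL, C0 | apply CM, C2].
Qed.

Lemma cubic_part_neg (x : R) : x <= 0 -> cubic_part x = 0.
Proof. intros H; unfold cubic_part; rewrite Rabs_left1 by assumption; ring. Qed.

Lemma cubic_part_pos (x : R) : 0 < x -> 0 < cubic_part x.
Proof.
intros H; unfold cubic_part; rewrite Rabs_right by lra.
apply Rmult_lt_0_compat; [apply pow_lt; assumption | lra].
Qed.

Lemma bump_out (c d t : R) : t <= c \/ d <= t -> bump c d t = 0.
Proof.
unfold bump; intros [H|H].
- rewrite (cubic_part_neg (t - c)) by lra; ring.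
- rewrite (cubic_part_neg (d - t)) by lra; ring.
Qed.

(** * The fundamental lemma of the calculus of variations *)

Lemma is_RInt_zero (f : R -> R) (a b : R) :
  a <= b -> (forall x, a < x < b -> f x = 0) -> is_RInt f a b 0.
Proof.
intros hab H.
apply (is_RInt_ext (fun _ => 0)).
- intros x Hx; rewrite Rmin_left, Rmax_right in Hx by lra; symmetry; auto.
- assert (E := is_RInt_const a b 0 : is_RInt (fun _ => 0) a b ((b - a) * 0)).
  rewrite Rmult_0_r in E; exact E.
Qed.

(** The support of the bump is a neighbourhood of [t0] on which [h] stays positive, cut down to
    [[a, b]]; it is nondegenerate even if [t0] is an endpoint. Outside it the integrand is zero,
    inside it is positive. *)
Lemma RInt_bump_pos (a b t0 : R) (h : R -> R) :
  a < b -> a <= t0 <= b -> (forall t, a <= t <= b -> continuity_pt h t) -> 0 < h t0 ->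
  exists c d, a <= c /\ d <= b /\ 0 < RInt (fun t => h t * bump c d t) a b.
Proof.
intros hab Ht Ch Hp.
assert (Hn : locally t0 (fun t => 0 < h t)).
{ apply (proj1 (continuity_pt_filterlim h t0) (Ch t0 Ht)); apply open_gt; assumption. }
destruct Hn as [e He]; assert (ep := cond_pos e).
exists (Rmax a (t0 - e)), (Rmin b (t0 + e)).
set (c := Rmax a (t0 - e)); set (d := Rmin b (t0 + e)).
assert (a <= c) by apply Rmax_l; assert (t0 - e <= c) by apply Rmax_r.
assert (d <= b) by apply Rmin_l; assert (d <= t0 + e) by apply Rmin_r.
assert (c < d) by (apply Rmax_lub_lt; apply Rmin_glb_lt; lra).
split; [assumption|split; [assumption|]].
assert (Cb : forall t, a <= t <= b -> continuous (fun t => h t * bump c d t) t).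
{ intros t It; apply (continuous_mult h).
  - apply continuity_pt_filterlim, Ch, It.
  - apply (ex_derive_continuous (bump c d)), (C2_on_at a b (bump c d) t); [apply C2_on_bump | exact It]. }
assert (I2 : is_RInt (fun t => h t * bump c d t) c d (RInt (fun t => h t * bump c d t) c d)).
{ apply (RInt_correct (fun t => h t * bump c d t)), (ex_RInt_continuous (fun t => h t * bump c d t)).
  intros z; rewrite Rmin_left, Rmax_right by lra; intros; apply Cb; lra. }
assert (I1 : is_RInt (fun t => h t * bump c d t) a c 0).
{ apply is_RInt_zero; [assumption|]; intros x Hx; rewrite bump_out by lra; ring. }
assert (I3 : is_RInt (fun t => h t * bump c d t) d b 0).
{ apply is_RInt_zero; [assumption|]; intros x Hx; rewrite bump_out by lra; ring. }
rewrite (is_RInt_unique _ _ _ _ (is_RInt_Chasles _ _ _ _ _ _ (is_RInt_Chasles _ _ _ _ _ _ I1 I2) I3)).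
change (0 < 0 + RInt (fun t => h t * bump c d t) c d + 0).
rewrite Rplus_0_l, Rplus_0_r.
apply RInt_gt_0; [assumption| |intros; apply Cb; lra].
intros x Hx; apply Rmult_lt_0_compat.
- apply He; change (Rabs (x - t0) < e); apply Rabs_def1; lra.
- apply Rmult_lt_0_compat; apply cubic_part_pos; lra.
Qed.

Lemma fundamental_lemma_variations (a b : R) (h : R -> R) :
  a < b -> (forall t, a <= t <= b -> continuity_pt h t) ->
  (forall xi, C2_on a b xi -> xi a = 0 -> xi b = 0 -> RInt (fun t => h t * xi t) a b = 0) ->
  forall t, a <= t <= b -> h t = 0.
Proof.
intros hab Ch H t Ht.
destruct (Rtotal_order (h t) 0) as [Hn|[Hz|Hp]]; [exfalso|assumption|exfalso].
(* A negative value of [h] is handled by applying the positive case to [- h]. *)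
- destruct (RInt_bump_pos a b t (fun t => - h t)) as [c [d [Hc [Hd Hi]]]]; try assumption; try lra.
  { intros x Hx; apply continuity_pt_opp, Ch, Hx. }
  assert (I : is_RInt (fun t => h t * bump c d t) a b (RInt (fun t => h t * bump c d t) a b)).
  { apply (RInt_correct (fun t => h t * bump c d t)), (ex_RInt_continuous (fun t => h t * bump c d t)).
    intros z; rewrite Rmin_left, Rmax_right by lra; intros Hz.
    apply (continuous_mult h); [apply continuity_pt_filterlim, Ch, Hz|].
    apply (ex_derive_continuous (bump c d)), (C2_on_at a b (bump c d) z); [apply C2_on_bump | exact Hz]. }
  rewrite H in I; [|apply C2_on_bump|apply bump_out; lra|apply bump_out; lra].
  apply is_RInt_opp, (is_RInt_ext _ (fun t => - h t * bump c d t)) in I.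
  + apply (is_RInt_unique (V := R_CompleteNormedModule)) in I; unfold opp in I; simpl in I; lra.
  + intros x _; unfold opp; simpl; ring.
- destruct (RInt_bump_pos a b t h) as [c [d [Hc [Hd Hi]]]]; try assumption.
  rewrite H in Hi; [lra|apply C2_on_bump|apply bump_out; lra|apply bump_out; lra].
Qed.

(** * The Lagrangian and differentiation under the integral sign *)

Definition lagrangian (lambda x y p q : R) : R := (x / y + lambda) * (sqrt (p ^ 2 + q ^ 2) / y).

(** The differential of [lagrangian] at position [(x, y)] and velocity [(p, q)], applied to
    [(dx, dy, dp, dq)]. It is written with products and inverses so that joint continuity can be
    proved factor by factor. *)
Definition lagrangian_diff (lambda x y p q dx dy dp dq : R) : R :=
  (dx * y - x * dy) * / (y * y) * (sqrt (p ^ 2 + q ^ 2) * / y)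
  + (x * / y + lambda)
    * ((p * dp + q * dq) * / sqrt (p ^ 2 + q ^ 2) * / y - sqrt (p ^ 2 + q ^ 2) * dy * / (y * y)).

Lemma is_derive_lagrangian (lambda x y p q dx dy dp dq s : R) :
  y + s * dy <> 0 -> 0 < (p + s * dp) ^ 2 + (q + s * dq) ^ 2 ->
  is_derive (fun s => lagrangian lambda (x + s * dx) (y + s * dy) (p + s * dp) (q + s * dq)) s
    (lagrangian_diff lambda (x + s * dx) (y + s * dy) (p + s * dp) (q + s * dq) dx dy dp dq).
Proof.
intros Hy Hm; unfold lagrangian, lagrangian_diff.
assert (HS := sqrt_lt_R0 _ Hm).
auto_derive.
- repeat split; try assumption; simpl in *; lra.
- simpl in *.
  replace ((p + s * dp) * ((p + s * dp) * 1) + (q + s * dq) * ((q + s * dq) * 1))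
    with ((p + s * dp) ^ 2 + (q + s * dq) ^ 2) in * by ring.
  set (S := sqrt _) in *.
  field; split; [assumption | lra].
Qed.

Lemma continuity_pt_1d_2d (f : R -> R) (s t : R) :
  continuity_pt f t -> continuity_2d_pt (fun _ t => f t) s t.
Proof.
intros H; apply (continuity_1d_2d_pt_comp f (fun _ t => t)); [exact H | apply continuity_2d_pt_id2].
Qed.

Lemma continuity_2d_pt_affine (f g : R -> R) (s t : R) :
  continuity_pt f t -> continuity_pt g t ->
  continuity_2d_pt (fun s t => f t + s * g t) s t.
Proof.
intros Hf Hg; apply continuity_2d_pt_plus; [apply continuity_pt_1d_2d, Hf|].
apply continuity_2d_pt_mult; [apply continuity_2d_pt_id1 | apply continuity_pt_1d_2d, Hg].
Qed.

Lemma continuity_2d_pt_sumsq (p q : R -> R -> R) (s t : R) :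
  continuity_2d_pt p s t -> continuity_2d_pt q s t ->
  continuity_2d_pt (fun s t => p s t ^ 2 + q s t ^ 2) s t.
Proof.
intros Hp Hq; apply continuity_2d_pt_plus;
  [apply (continuity_2d_pt_mult p (fun s t => p s t * 1)) | apply (continuity_2d_pt_mult q (fun s t => q s t * 1))];
  try assumption; apply continuity_2d_pt_mult; try assumption; apply continuity_2d_pt_const.
Qed.

Lemma continuity_2d_pt_sqrt (f : R -> R -> R) (s t : R) :
  continuity_2d_pt f s t -> continuity_2d_pt (fun s t => sqrt (f s t)) s t.
Proof.
intros H; apply continuity_1d_2d_pt_comp; [|exact H].
apply continuity_pt_filterlim; apply continuous_sqrt.
Qed.

(** Differentiation under the integral sign asks for the derivative in [s] to be jointly continuous
    in the parameter [s] and the time [t]. *)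
Lemma continuity_2d_pt_lagrangian_diff (lambda : R) (x y p q : R -> R -> R) (dx dy dp dq : R -> R) (s t : R) :
  continuity_2d_pt x s t -> continuity_2d_pt y s t ->
  continuity_2d_pt p s t -> continuity_2d_pt q s t ->
  continuity_pt dx t -> continuity_pt dy t -> continuity_pt dp t -> continuity_pt dq t ->
  y s t <> 0 -> 0 < p s t ^ 2 + q s t ^ 2 ->
  continuity_2d_pt (fun s t => lagrangian_diff lambda (x s t) (y s t) (p s t) (q s t)
                                 (dx t) (dy t) (dp t) (dq t)) s t.
Proof.
intros Hx Hy Hp Hq Hdx Hdy Hdp Hdq Hy0 Hm; unfold lagrangian_diff.
assert (HS := sqrt_lt_R0 _ Hm).
assert (HC := continuity_2d_pt_sqrt _ _ _ (continuity_2d_pt_sumsq p q s t Hp Hq)).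
assert (Hyy : y s t * y s t <> 0) by (apply Rmult_integral_contrapositive; split; assumption).
repeat first
  [ assumption
  | exact HC
  | apply continuity_pt_1d_2d; assumption
  | apply continuity_2d_pt_const
  | apply continuity_2d_pt_minus
  | apply continuity_2d_pt_plus
  | apply continuity_2d_pt_mult
  | apply continuity_2d_pt_inv; [|solve [assumption | lra]] ].
Qed.

Lemma continuity_pt_lagrangian (lambda : R) (x y p q : R -> R) (t : R) :
  continuity_pt x t -> continuity_pt y t -> continuity_pt p t -> continuity_pt q t ->
  y t <> 0 -> continuity_pt (fun t => lagrangian lambda (x t) (y t) (p t) (q t)) t.
Proof.
intros Hx Hy Hp Hq Hy0; unfold lagrangian.
assert (Hsq : forall f, continuity_pt f t -> continuity_pt (fun t => f t ^ 2) t).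
{ intros f Hf; apply (continuity_pt_comp f (fun x => x ^ 2)); [exact Hf|].
  apply derivable_continuous_pt, derivable_pt_pow. }
apply continuity_pt_mult.
- apply continuity_pt_plus; [apply continuity_pt_div; assumption|].
  apply continuity_const; intros ? ?; reflexivity.
- apply continuity_pt_div; [|assumption|assumption].
  apply (continuity_pt_comp (fun t => p t ^ 2 + q t ^ 2) sqrt).
  + apply continuity_pt_plus; auto.
  + apply continuity_pt_filterlim; apply continuous_sqrt.
Qed.

Lemma sumsq_pos (p q : R) : (p, q) <> (0, 0) -> 0 < p ^ 2 + q ^ 2.
Proof.
intros H.
assert (0 <= p ^ 2) by apply pow2_ge_0; assert (0 <= q ^ 2) by apply pow2_ge_0.
destruct (Req_dec p 0) as [Hp|Hp].
- destruct (Req_dec q 0) as [Hq|Hq]; [subst; contradiction|].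
  assert (0 < q ^ 2) by (apply pow2_gt_0; assumption); lra.
- assert (0 < p ^ 2) by (apply pow2_gt_0; assumption); lra.
Qed.

Lemma locally_2d_pos (f : R -> R -> R) (s t : R) :
  continuity_2d_pt f s t -> 0 < f s t -> locally_2d (fun s t => 0 < f s t) s t.
Proof.
intros Hc Hp; destruct (Hc (mkposreal _ Hp)) as [d Hd]; exists d; intros x y Hx Hy.
specialize (Hd x y Hx Hy); simpl in Hd; apply Rabs_def2 in Hd; lra.
Qed.

(** [is_derive_RInt_param] moves the derivative in [s] inside the integral. For [s] near [0],
    uniformly in [t], the varied curve keeps positive height [Y] and nonzero speed, so there the
    integrand is smooth in [s] with derivative [dF]. *)
Lemma is_derive_energy_hor (lambda a b : R) (u v xi eta : R -> R) :
  a < b -> regular_curve_in_Hplus a b u v -> C2_on a b xi -> C2_on a b eta ->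
  is_derive (fun s => energy_hor lambda a b (fun t => u t + s * xi t) (fun t => v t + s * eta t)) 0
    (RInt (fun t => lagrangian_diff lambda (u t) (v t) (Derive u t) (Derive v t)
                      (xi t) (eta t) (Derive xi t) (Derive eta t)) a b).
Proof.
intros hab [Hu [Hv Hr]] Hxi Heta.
assert (Cu : forall f, C2_on a b f -> forall t, a <= t <= b ->
  continuity_pt f t /\ continuity_pt (Derive f) t /\ ex_derive f t).
{ intros f Hf t Ht; destruct (C2_on_at _ _ _ _ Hf Ht) as [H1 [H2 _]].
  auto using ex_derive_continuity_pt. }
set (Y := fun s t => v t + s * eta t).
set (P := fun s t => Derive u t + s * Derive xi t).
set (Q := fun s t => Derive v t + s * Derive eta t).
set (F := fun s t => lagrangian lambda (u t + s * xi t) (Y s t) (P s t) (Q s t)).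
set (dF := fun s t => lagrangian_diff lambda (u t + s * xi t) (Y s t) (P s t) (Q s t)
                      (xi t) (eta t) (Derive xi t) (Derive eta t)).
assert (Hpos : locally 0 (fun s => forall t, a <= t <= b -> 0 < Y s t /\ 0 < P s t ^ 2 + Q s t ^ 2)).
{ assert (L1 : locally 0 (fun s => forall t, a <= t <= b -> 0 < v t + s * eta t)).
  { apply perturbation_pos; [lra| | |]; intros t Ht; try apply Cu; try assumption; apply Hr, Ht. }
  (* This is the part of the varied squared speed that is affine in [s]; the remaining term
     [s^2 (xi'^2 + eta'^2)] is nonnegative. *)
  assert (L2 : locally 0 (fun s => forall t, a <= t <= b ->
     0 < (Derive u t ^ 2 + Derive v t ^ 2) + s * (2 * (Derive u t * Derive xi t + Derive v t * Derive eta t)))).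
  { apply perturbation_pos; [lra| | |]; intros t Ht.
    - apply continuity_pt_plus; apply (continuity_pt_comp _ (fun x => x ^ 2));
        try (apply Cu; assumption); apply derivable_continuous_pt, derivable_pt_pow.
    - apply continuity_pt_mult; [apply continuity_const; intros ? ?; reflexivity|].
      apply continuity_pt_plus; apply continuity_pt_mult; apply Cu; assumption.
    - apply sumsq_pos, Hr, Ht. }
  generalize (filter_and _ _ L1 L2); apply filter_imp; intros s [H1 H2] t Ht.
  split; [apply H1, Ht|]; specialize (H2 t Ht).
  assert (E := pow2_ge_0 (s * Derive xi t)); assert (E2 := pow2_ge_0 (s * Derive eta t)).
  unfold P, Q; nra. }
assert (HdF : forall s t, 0 < Y s t -> 0 < P s t ^ 2 + Q s t ^ 2 -> is_derive (fun s => F s t) s (dF s t)).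
{ intros s t H1 H2; apply is_derive_lagrangian; [unfold Y in H1; lra | exact H2]. }
assert (Hc : forall s, (forall t, a <= t <= b -> 0 < Y s t /\ 0 < P s t ^ 2 + Q s t ^ 2) ->
  forall t, a <= t <= b -> continuity_2d_pt dF s t).
{ intros s Hs t Ht; destruct (Hs t Ht) as [H1 H2].
  apply (continuity_2d_pt_lagrangian_diff lambda (fun s t => u t + s * xi t) Y P Q);
    try apply continuity_2d_pt_affine; try apply Cu; try assumption; lra. }
assert (H0 : forall t, a <= t <= b -> 0 < Y 0 t /\ 0 < P 0 t ^ 2 + Q 0 t ^ 2).
{ apply (locally_singleton 0 _ Hpos). }
(* On the interval of integration the velocity of the varied curve is [(P s t, Q s t)], which
   identifies the energy integrand with [F]. *)
apply (is_derive_ext (fun s => RInt (fun t => F s t) a b)).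
{ intros s; unfold energy_hor; apply RInt_ext; intros t Ht.
  rewrite Rmin_left, Rmax_right in Ht by lra.
  assert (It : a <= t <= b) by lra.
  assert (E : forall f g, C2_on a b f -> C2_on a b g ->
            Derive (fun t => f t + s * g t) t = Derive f t + s * Derive g t).
  { intros f g Hf Hg; apply is_derive_unique; auto_derive.
    - repeat split; [apply (Cu f Hf t It) | apply (Cu g Hg t It)].
    - change (1 * Derive f t + s * (1 * Derive g t) = Derive f t + s * Derive g t); ring. }
  unfold F, lagrangian, speed2, d_hor, Y, P, Q; simpl fst; simpl snd.
  rewrite (E u xi), (E v eta) by assumption; reflexivity. }
replace (RInt _ a b) with (RInt (fun t => Derive (fun s => F s t) 0) a b).
- apply is_derive_RInt_param; try rewrite Rmin_left, Rmax_right by lra.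
  + revert Hpos; apply filter_imp; intros s Hs t Ht.
    eexists; apply HdF; apply Hs, Ht.
  (* The derivative of [F] in [s] is known to be [dF] where height and squared speed are positive;
     by joint continuity this holds near [(0, t)]. *)
  + intros t Ht; apply (continuity_2d_pt_ext_loc dF).
    * destruct (H0 t Ht) as [Y0 M0].
      assert (CP : continuity_2d_pt P 0 t) by (apply continuity_2d_pt_affine; apply Cu; assumption).
      assert (CQ : continuity_2d_pt Q 0 t) by (apply continuity_2d_pt_affine; apply Cu; assumption).
      assert (CY : continuity_2d_pt Y 0 t) by (apply continuity_2d_pt_affine; apply Cu; assumption).
      generalize (locally_2d_and _ _ _ _ (locally_2d_pos _ _ _ CY Y0)
        (locally_2d_pos _ _ _ (continuity_2d_pt_sumsq _ _ _ _ CP CQ) M0)).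
      intros [d Hd]; exists d; intros x y Hx Hy; symmetry.
      apply is_derive_unique, HdF; apply (Hd x y Hx Hy).
    * apply Hc; assumption.
  + revert Hpos; apply filter_imp; intros s Hs.
    apply (ex_RInt_continuous (F s)); rewrite Rmin_left, Rmax_right by lra.
    intros t Ht; apply continuity_pt_filterlim.
    assert (CA : forall f g, C2_on a b f -> C2_on a b g ->
      continuity_pt (fun t => f t + s * g t) t /\
      continuity_pt (fun t => Derive f t + s * Derive g t) t).
    { intros f g Hf Hg; split; apply continuity_pt_plus; try (apply Cu; assumption);
      apply continuity_pt_mult; try (apply Cu; assumption);
      apply continuity_const; intros ? ?; reflexivity. }
    apply continuity_pt_lagrangian; try (apply CA; assumption).
    destruct (Hs t Ht); lra.
- apply RInt_ext; intros t; rewrite Rmin_left, Rmax_right by lra; intros Ht.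
  destruct (H0 t) as [Y0 M0]; [lra|].
  transitivity (dF 0 t); [apply is_derive_unique, HdF; assumption|].
  unfold dF, Y, P, Q; rewrite !Rmult_0_l, !Rplus_0_r; reflexivity.
Qed.

(** * Curvature, defect and Euler-Lagrange expression along the curve *)

(* This is [sqrt m * kappa_h] (lemma [kappa_h_sqrt]), written without roots. *)
Definition scaled_curvature (u v : R -> R) (t : R) : R :=
  v t * (Derive u t * Derive (Derive v) t - Derive (Derive u) t * Derive v t) / speed2 u v t
  + Derive u t.

(** The quantity [N] of the overview: the curvature equation cleared of denominators, hence still
    informative where [d_hor + lambda] vanishes. *)
Definition horo_defect (lambda : R) (u v : R -> R) (t : R) : R :=
  (d_hor (u t, v t) + lambda) * (v t * scaled_curvature u v t)
  + (u t * Derive u t + v t * Derive v t).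

(* The two Euler-Lagrange expressions of the energy are [v' * euler_lagrange] and
   [- u' * euler_lagrange]: parametrization invariance leaves a single equation. *)
Definition euler_lagrange (lambda : R) (u v : R -> R) (t : R) : R :=
  horo_defect lambda u v t / (v t ^ 3 * sqrt (speed2 u v t)).

Lemma Rpower_3_2 (m : R) : 0 < m -> Rpower m (3 / 2) = sqrt m ^ 3.
Proof.
intros Hm; replace (3 / 2) with (1 + / 2) by field.
rewrite Rpower_plus, Rpower_1, Rpower_sqrt by assumption.
rewrite <- (sqrt_sqrt m) at 1 by lra; ring.
Qed.

Lemma regular_curve_at (a b : R) (u v : R -> R) (t : R) :
  regular_curve_in_Hplus a b u v -> a <= t <= b ->
  0 < u t /\ 0 < v t /\ 0 < speed2 u v t /\
  ex_derive u t /\ ex_derive v t /\ ex_derive (Derive u) t /\ ex_derive (Derive v) t /\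
  continuity_pt (Derive (Derive u)) t /\ continuity_pt (Derive (Derive v)) t.
Proof.
intros [Hu [Hv Hr]] Ht.
destruct (Hr t Ht) as [[H1 H2] H3].
destruct (C2_on_at _ _ _ _ Hu Ht) as [U1 [U2 U3]].
destruct (C2_on_at _ _ _ _ Hv Ht) as [V1 [V2 V3]].
repeat split; try assumption.
- apply sumsq_pos, H3.
- apply continuity_pt_filterlim, U3.
- apply continuity_pt_filterlim, V3.
Qed.

Ltac cpt :=
  repeat first
  [ assumption
  | apply ex_derive_continuity_pt; assumption
  | apply continuity_const; intros ? ?; reflexivity
  | apply continuity_pt_plus
  | apply continuity_pt_opp
  | apply continuity_pt_mult ].

Lemma kappa_h_sqrt (u v : R -> R) (t : R) :
  0 < speed2 u v t -> kappa_h u v t * sqrt (speed2 u v t) = scaled_curvature u v t.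
Proof.
intros Hm; unfold kappa_h, scaled_curvature; rewrite Rpower_3_2 by assumption.
assert (HS := sqrt_lt_R0 _ Hm); assert (HSS := sqrt_sqrt (speed2 u v t)).
(* The fourth occurrence of [speed2] is the denominator in [scaled_curvature]; writing it as a
   square of [sqrt m] leaves an identity of rational functions. *)
rewrite <- HSS at 4 by lra; field; lra.
Qed.

Lemma continuity_pt_speed2 (u v : R -> R) (t : R) :
  ex_derive (Derive u) t -> ex_derive (Derive v) t -> continuity_pt (speed2 u v) t.
Proof.
intros Hu Hv; unfold speed2; simpl; cpt.
Qed.

Lemma continuity_pt_scaled_curvature (a b : R) (u v : R -> R) (t : R) :
  regular_curve_in_Hplus a b u v -> a <= t <= b ->
  continuity_pt (scaled_curvature u v) t.
Proof.
unfold scaled_curvature.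
intros Hr Ht; destruct (regular_curve_at _ _ _ _ _ Hr Ht) as (?&?&?&?&?&?&?&?&?).
assert (H8 := continuity_pt_speed2 u v t H4 H5).
apply continuity_pt_plus; [apply continuity_pt_div|]; cpt; lra.
Qed.

Lemma continuity_pt_d_hor (lambda : R) (u v : R -> R) (t : R) :
  ex_derive u t -> ex_derive v t -> v t <> 0 ->
  continuity_pt (fun t => d_hor (u t, v t) + lambda) t.
Proof.
intros Hu Hv H; unfold d_hor; simpl.
apply continuity_pt_plus; [apply continuity_pt_div|]; cpt.
Qed.

Lemma continuity_pt_horo_defect (lambda a b : R) (u v : R -> R) (t : R) :
  regular_curve_in_Hplus a b u v -> a <= t <= b ->
  continuity_pt (horo_defect lambda u v) t.
Proof.
intros Hr Ht; destruct (regular_curve_at _ _ _ _ _ Hr Ht) as (?&?&?&?&?&?&?&?&?).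
assert (Hk := continuity_pt_scaled_curvature _ _ _ _ _ Hr Ht).
assert (Hd : continuity_pt (fun t => d_hor (u t, v t) + lambda) t)
  by (apply continuity_pt_d_hor; try assumption; lra).
unfold horo_defect; apply continuity_pt_plus; [|cpt].
apply continuity_pt_mult; cpt.
Qed.

Lemma continuity_pt_euler_lagrange (lambda a b : R) (u v : R -> R) (t : R) :
  regular_curve_in_Hplus a b u v -> a <= t <= b ->
  continuity_pt (euler_lagrange lambda u v) t.
Proof.
intros Hr Ht; destruct (regular_curve_at _ _ _ _ _ Hr Ht) as (?&?&?&?&?&?&?&?&?).
assert (HS := sqrt_lt_R0 _ H1).
apply continuity_pt_div; [apply (continuity_pt_horo_defect _ _ _ _ _ _ Hr Ht)| |].
- apply continuity_pt_mult.
  + apply (continuity_pt_comp v (fun x => x ^ 3)); [cpt|].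
    apply derivable_continuous_pt, derivable_pt_pow.
  + apply (continuity_pt_comp (speed2 u v) sqrt); [apply continuity_pt_speed2; assumption|].
    apply continuity_pt_filterlim; apply continuous_sqrt.
- apply Rgt_not_eq, Rmult_lt_0_compat; [apply pow_lt|]; assumption.
Qed.

(** Lets the joint continuity of [lagrangian_diff] be reused for the first variation integrand along
    the unvaried curve. *)
Lemma continuity_2d_pt_1d (f : R -> R) (s t : R) :
  continuity_2d_pt (fun _ t => f t) s t -> continuity_pt f t.
Proof.
intros H e He; destruct (H (mkposreal e He)) as [d Hd].
exists d; split; [apply cond_pos|]; intros y [_ Hy].
apply (Hd s y); [rewrite Rminus_diag, Rabs_R0; apply cond_pos | exact Hy].
Qed.

(** * Integration by parts and the equation of critical points *)

(* Integration by parts: [boundary term]' = first variation - Euler-Lagrange integrand. *)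
Lemma is_derive_boundary_term (lambda a b : R) (u v xi eta : R -> R) (t : R) :
  regular_curve_in_Hplus a b u v -> a <= t <= b -> ex_derive xi t -> ex_derive eta t ->
  is_derive (fun t => (u t / v t + lambda) / v t * (Derive u t * xi t + Derive v t * eta t)
                      / sqrt (speed2 u v t)) t
    (lagrangian_diff lambda (u t) (v t) (Derive u t) (Derive v t)
       (xi t) (eta t) (Derive xi t) (Derive eta t)
     - euler_lagrange lambda u v t * (Derive v t * xi t - Derive u t * eta t)).
Proof.
intros Hr Ht Hxi Heta; destruct (regular_curve_at _ _ _ _ _ Hr Ht) as (?&?&?&?&?&?&?&?&?).
unfold euler_lagrange, horo_defect, scaled_curvature.
unfold lagrangian_diff, d_hor, speed2 in *; simpl fst; simpl snd.
assert (HS := sqrt_lt_R0 _ H1).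
auto_derive.
- simpl in *; repeat split; try assumption; try lra.
- change (fun x : R => u x) with u; change (fun x : R => v x) with v.
  change (fun x : R => xi x) with xi; change (fun x : R => eta x) with eta.
  change (fun x : R => Derive u x) with (Derive u); change (fun x : R => Derive v x) with (Derive v).
  match goal with |- context [sqrt ?e] => replace e with (Derive u t ^ 2 + Derive v t ^ 2) by ring end.
  assert (HSS := sqrt_sqrt (Derive u t ^ 2 + Derive v t ^ 2)).
  set (S := sqrt _) in *.
  set (p := Derive u t) in *; set (q := Derive v t) in *.
  set (p1 := Derive (Derive u) t) in *; set (q1 := Derive (Derive v) t) in *.
  (* The one relation between [S = sqrt m] and the velocity; modulo it the claim is a ring
     identity. *)
  assert (Hp : p ^ 2 = S ^ 2 - q ^ 2) by (simpl in *; lra).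
  field_simplify_eq [Hp]; [ring [Hp]|]; repeat split; lra.
Qed.

(** The two integrands differ by the derivative of the boundary term, which vanishes at [a] and [b]
    together with [xi] and [eta]. *)
Lemma RInt_lagrangian_diff (lambda a b : R) (u v xi eta : R -> R) :
  a < b -> regular_curve_in_Hplus a b u v -> C2_on a b xi -> C2_on a b eta ->
  xi a = 0 -> xi b = 0 -> eta a = 0 -> eta b = 0 ->
  RInt (fun t => lagrangian_diff lambda (u t) (v t) (Derive u t) (Derive v t)
                   (xi t) (eta t) (Derive xi t) (Derive eta t)) a b
  = RInt (fun t => euler_lagrange lambda u v t * (Derive v t * xi t - Derive u t * eta t)) a b.
Proof.
intros hab Hr Hxi Heta xa xb ea eb.
set (g := fun t => lagrangian_diff lambda (u t) (v t) (Derive u t) (Derive v t)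
                   (xi t) (eta t) (Derive xi t) (Derive eta t)).
set (h := fun t => euler_lagrange lambda u v t * (Derive v t * xi t - Derive u t * eta t)).
assert (Cg : forall t, a <= t <= b -> continuity_pt g t).
{ intros t Ht; destruct (regular_curve_at _ _ _ _ _ Hr Ht) as (?&?&?&?&?&?&?&?&?).
  destruct (C2_on_at _ _ _ _ Hxi Ht) as [? [? _]]; destruct (C2_on_at _ _ _ _ Heta Ht) as [? [? _]].
  apply (continuity_2d_pt_1d g 0).
  apply (continuity_2d_pt_lagrangian_diff lambda (fun _ t => u t) (fun _ t => v t)
    (fun _ t => Derive u t) (fun _ t => Derive v t));
    try apply continuity_pt_1d_2d; try (apply ex_derive_continuity_pt; assumption);
    [lra | assumption]. }
assert (Ch : forall t, a <= t <= b -> continuity_pt h t).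
{ intros t Ht; destruct (regular_curve_at _ _ _ _ _ Hr Ht) as (?&?&?&?&?&?&?&?&?).
  destruct (C2_on_at _ _ _ _ Hxi Ht) as [? _]; destruct (C2_on_at _ _ _ _ Heta Ht) as [? _].
  apply continuity_pt_mult; [apply (continuity_pt_euler_lagrange _ _ _ _ _ _ Hr Ht)|].
  apply continuity_pt_minus; cpt. }
assert (ex : forall f, (forall t, a <= t <= b -> continuity_pt f t) -> ex_RInt f a b).
{ intros f Hf; apply (ex_RInt_continuous f); rewrite Rmin_left, Rmax_right by lra.
  intros t Ht; apply continuity_pt_filterlim, Hf, Ht. }
assert (Hz : is_RInt (fun t => g t - h t) a b 0).
{ replace 0 with (minus
    ((fun t => (u t / v t + lambda) / v t * (Derive u t * xi t + Derive v t * eta t)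
                      / sqrt (speed2 u v t)) b)
    ((fun t => (u t / v t + lambda) / v t * (Derive u t * xi t + Derive v t * eta t)
                      / sqrt (speed2 u v t)) a)).
  - apply (is_RInt_derive (fun t => (u t / v t + lambda) / v t * (Derive u t * xi t + Derive v t * eta t)
                      / sqrt (speed2 u v t)) (fun t => g t - h t));
      rewrite Rmin_left, Rmax_right by lra; intros t Ht.
    + apply (is_derive_boundary_term lambda a b); try assumption.
      * apply (C2_on_at _ _ _ _ Hxi Ht).
      * apply (C2_on_at _ _ _ _ Heta Ht).
    + apply continuity_pt_filterlim; apply continuity_pt_minus; auto.
  - unfold minus, plus, opp; simpl; rewrite xa, xb, ea, eb; unfold Rdiv; ring. }
apply (is_RInt_unique (V := R_CompleteNormedModule)) in Hz.
assert (E := RInt_minus (V := R_CompleteNormedModule) g h a b (ex g Cg) (ex h Ch)).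
change (RInt (fun t => g t - h t) a b = RInt g a b - RInt h a b) in E; lra.
Qed.

(** Varying one coordinate at a time, the fundamental lemma gives [euler_lagrange * u' = 0] and
    [euler_lagrange * v' = 0]; since the velocity never vanishes, [euler_lagrange] does. Conversely
    a zero defect makes the first variation integrand, after integration by parts, identically
    zero. *)
Lemma horo_catenary_iff_defect (lambda a b : R) (u v : R -> R) :
  a < b -> regular_curve_in_Hplus a b u v ->
  horo_catenary lambda a b u v <-> (forall t, a <= t <= b -> horo_defect lambda u v t = 0).
Proof.
intros hab Hr; split.
- intros Hc.
  assert (H : forall xi eta, C2_on a b xi -> C2_on a b eta ->
    xi a = 0 -> xi b = 0 -> eta a = 0 -> eta b = 0 ->
    RInt (fun t => euler_lagrange lambda u v t * (Derive v t * xi t - Derive u t * eta t)) a b = 0).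
  { intros xi eta Hxi Heta xa xb ea eb.
    rewrite <- RInt_lagrangian_diff by assumption.
    rewrite <- (is_derive_unique _ _ _ (is_derive_energy_hor lambda a b u v xi eta hab Hr Hxi Heta)).
    apply is_derive_unique, Hc; assumption. }
  assert (C0 : C2_on a b (fun _ => 0)).
  { apply (C2_on_intro a b _ (fun _ => 0) (fun _ => 0)); intros x;
      [apply (is_derive_const 0) | apply (is_derive_const 0) | apply continuous_const]. }
  assert (Hu : forall t, a <= t <= b -> - (euler_lagrange lambda u v t * Derive u t) = 0).
  { apply fundamental_lemma_variations; [assumption| |].
    - intros t Ht; destruct (regular_curve_at _ _ _ _ _ Hr Ht) as (?&?&?&?&?&?&?&?&?).
      apply continuity_pt_opp, continuity_pt_mult;
        [apply (continuity_pt_euler_lagrange _ _ _ _ _ _ Hr Ht)|cpt].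
    - intros eta He ea eb.
      rewrite <- (H (fun _ => 0) eta) by (try assumption; reflexivity).
      apply RInt_ext; ring_R. }
  assert (Hv : forall t, a <= t <= b -> euler_lagrange lambda u v t * Derive v t = 0).
  { apply fundamental_lemma_variations; [assumption| |].
    - intros t Ht; destruct (regular_curve_at _ _ _ _ _ Hr Ht) as (?&?&?&?&?&?&?&?&?).
      apply continuity_pt_mult; [apply (continuity_pt_euler_lagrange _ _ _ _ _ _ Hr Ht)|cpt].
    - intros xi Hxi xa xb.
      rewrite <- (H xi (fun _ => 0)) by (try assumption; reflexivity).
      apply RInt_ext; ring_R. }
  intros t Ht; destruct (regular_curve_at _ _ _ _ _ Hr Ht) as (?&?&?&_).
  specialize (Hu t Ht); apply Ropp_eq_0_compat in Hu; rewrite Ropp_involutive in Hu; specialize (Hv t Ht).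
  assert (HS := sqrt_lt_R0 _ H2); unfold speed2 in H2.
  assert (HE : euler_lagrange lambda u v t = 0).
  { destruct (Rmult_integral _ _ Hu) as [?|E1]; [assumption|].
    destruct (Rmult_integral _ _ Hv) as [?|E2]; [assumption|].
    rewrite E1, E2 in H2; lra. }
  unfold euler_lagrange in HE; apply Rmult_integral in HE; destruct HE as [HE|HE]; [exact HE|].
  exfalso; revert HE; apply Rinv_neq_0_compat, Rgt_not_eq, Rmult_lt_0_compat; [apply pow_lt|]; assumption.
- intros H xi eta Hxi Heta xa xb ea eb.
  (* The second [0] is the value of the derivative; the first is the base point. *)
  replace 0 with (RInt (fun t => lagrangian_diff lambda (u t) (v t) (Derive u t) (Derive v t)
                      (xi t) (eta t) (Derive xi t) (Derive eta t)) a b) at 2.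
  + apply is_derive_energy_hor; assumption.
  + rewrite RInt_lagrangian_diff by assumption.
    apply (is_RInt_unique (V := R_CompleteNormedModule)), is_RInt_zero; [lra|].
    intros t Ht; unfold euler_lagrange; rewrite H by lra; unfold Rdiv; ring.
Qed.

(** * Behaviour at the zeros of [d_hor + lambda] *)

Lemma is_derive_horo_ratio (lambda : R) (u v : R -> R) (t : R) :
  ex_derive u t -> ex_derive v t -> v t <> 0 ->
  is_derive (fun t => d_hor (u t, v t) + lambda) t
    ((Derive u t * v t - u t * Derive v t) / (v t * v t)).
Proof.
intros Hu Hv H; unfold d_hor; simpl; auto_derive; [repeat split; assumption|].
change (fun x : R => u x) with u; change (fun x : R => v x) with v; field; assumption.
Qed.

Lemma kappa_h_zero_iff (u v : R -> R) (t : R) :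
  0 < speed2 u v t -> kappa_h u v t = 0 <-> scaled_curvature u v t = 0.
Proof.
intros Hm; rewrite <- kappa_h_sqrt by assumption; assert (HS := sqrt_lt_R0 _ Hm).
split; intros H; [rewrite H; ring|].
apply Rmult_integral in H; destruct H; [assumption|lra].
Qed.

(* At a zero of [d_hor + lambda] the defect only yields [u u' + v v' = 0]; its derivative yields [kappa_h = 0]. *)
Lemma kappa_h_singular (lambda a b : R) (u v : R -> R) (t : R) :
  a < b -> regular_curve_in_Hplus a b u v ->
  (forall t, a <= t <= b -> horo_defect lambda u v t = 0) ->
  a <= t <= b -> d_hor (u t, v t) + lambda = 0 -> kappa_h u v t = 0.
Proof.
intros hab Hr HN Ht HD; destruct (regular_curve_at _ _ _ _ _ Hr Ht) as (?&?&?&?&?&?&?&?&?).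
apply kappa_h_zero_iff; [assumption|].
assert (Hq := HN t Ht); unfold horo_defect in Hq; rewrite HD in Hq.
(* The curvature already contains second derivatives and is only continuous, so the first product is
   differentiated through its factor [d_hor + lambda], which vanishes at [t]. *)
assert (Hd : is_derive (horo_defect lambda u v) t
  ((Derive u t * v t - u t * Derive v t) / (v t * v t) * (v t * scaled_curvature u v t)
   + (Derive u t ^ 2 + u t * Derive (Derive u) t + Derive v t ^ 2 + v t * Derive (Derive v) t))).
{ apply (is_derive_plus (fun t => (d_hor (u t, v t) + lambda) * (v t * scaled_curvature u v t))
    (fun t => u t * Derive u t + v t * Derive v t)).
  - apply (is_derive_mult_root (fun t => d_hor (u t, v t) + lambda) (fun t => v t * scaled_curvature u v t)).
    + apply is_derive_horo_ratio; try assumption; lra.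
    + exact HD.
    + assert (Hk := continuity_pt_scaled_curvature _ _ _ _ _ Hr Ht); cpt.
  - auto_derive; [repeat split; assumption|].
    change (fun x : R => u x) with u; change (fun x : R => v x) with v.
    change (fun x : R => Derive u x) with (Derive u); change (fun x : R => Derive v x) with (Derive v); ring. }
apply (is_derive_zero_on_interval _ a b) in Hd; [|assumption|assumption|assumption].
unfold scaled_curvature, speed2 in *.
set (x := u t) in *; set (y := v t) in *; set (p := Derive u t) in *; set (q := Derive v t) in *.
set (p1 := Derive (Derive u) t) in *; set (q1 := Derive (Derive v) t) in *.
set (m := p ^ 2 + q ^ 2) in *.
set (k := y * (p * q1 - p1 * q) / m + p) in *.
set (W := p * y - x * q) in *.
(* [W] is [y^2] times the derivative of [d_hor + lambda]. Orthogonality [x p + y q = 0] evaluates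
   [W p] and [W q]; as [m y] is positive, the former gives [W <> 0]. *)
assert (HWp : W * p = m * y).
{ replace (W * p) with (p ^ 2 * y - (x * p + y * q) * q + y * q ^ 2) by (unfold W; ring).
  replace (x * p + y * q) with 0 by lra; unfold m; ring. }
assert (HWq : W * q = - (m * x)).
{ replace (W * q) with ((x * p + y * q) * p - x * (p ^ 2 + q ^ 2)) by (unfold W; ring).
  replace (x * p + y * q) with 0 by lra; unfold m; ring. }
(* The two summands of the derivative of the defect coincide, so their zero sum makes each of them
   zero. *)
assert (HWk : W / (y * y) * (y * k) = p ^ 2 + x * p1 + q ^ 2 + y * q1).
{ replace (W / (y * y) * (y * k)) with (((W * p) * q1 - (W * q) * p1) / m + (W * p) / y)
    by (unfold k; field; lra).
  rewrite HWp, HWq; replace (p ^ 2 + x * p1 + q ^ 2 + y * q1) with (m + x * p1 + y * q1) by (unfold m; ring).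
  field; lra. }
assert (Hz : W / (y * y) * (y * k) = 0) by lra.
assert (HW0 : W <> 0).
{ intros HW0; rewrite HW0, Rmult_0_l in HWp.
  symmetry in HWp; apply Rmult_integral in HWp; lra. }
replace (W / (y * y) * (y * k)) with (W * k * / y) in Hz by (field; lra).
apply Rmult_integral in Hz; destruct Hz as [Hz|Hz].
- apply Rmult_integral in Hz; destruct Hz as [Hz|Hz]; [contradiction | exact Hz].
- exfalso; revert Hz; apply Rinv_neq_0_compat; lra.
Qed.

(** A nonzero defect at [t0] persists nearby, so [d_hor + lambda] vanishes on a whole interval.
    There [u / v] is constant, and its first two derivatives combined with [kappa_h = 0] force the
    velocity to be zero, against regularity. *)
Lemma horo_defect_zero (lambda a b : R) (u v : R -> R) (t0 : R) :
  a < b -> regular_curve_in_Hplus a b u v ->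
  (forall t, a <= t <= b -> d_hor (u t, v t) + lambda <> 0 -> horo_defect lambda u v t = 0) ->
  (forall t, a <= t <= b -> d_hor (u t, v t) + lambda = 0 -> kappa_h u v t = 0) ->
  a <= t0 <= b -> horo_defect lambda u v t0 = 0.
Proof.
intros hab Hr HN Hk Ht0.
destruct (Req_dec (horo_defect lambda u v t0) 0) as [|Hne]; [assumption|exfalso].
assert (Hl : locally t0 (fun t => horo_defect lambda u v t <> 0)).
{ exact (proj1 (continuity_pt_filterlim _ t0) (continuity_pt_horo_defect lambda a b u v t0 Hr Ht0)
    (fun y => y <> 0) (open_neq 0 _ Hne)). }
destruct Hl as [e He]; assert (ep := cond_pos e).
(* Halving [e] puts the closed interval from [c] to [d] inside the open ball where the defect is
   nonzero. *)
set (c := Rmax a (t0 - e / 2)); set (d := Rmin b (t0 + e / 2)).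
assert (a <= c) by apply Rmax_l; assert (t0 - e / 2 <= c) by apply Rmax_r.
assert (d <= b) by apply Rmin_l; assert (d <= t0 + e / 2) by apply Rmin_r.
assert (hcd : c < d) by (apply Rmax_lub_lt; apply Rmin_glb_lt; lra).
assert (HD : forall t, c <= t <= d -> d_hor (u t, v t) + lambda = 0).
{ intros t Ht; destruct (Req_dec (d_hor (u t, v t) + lambda) 0) as [|Hd]; [assumption|exfalso].
  apply (He t); [change (Rabs (t - t0) < e); apply Rabs_def1; lra|].
  apply HN; [lra | exact Hd]. }
assert (HW : forall t, c <= t <= d -> Derive u t * v t - u t * Derive v t = 0).
{ intros t Ht; assert (It : a <= t <= b) by lra.
  destruct (regular_curve_at _ _ _ _ _ Hr It) as (?&?&?&?&?&?&?&?&?).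
  assert (Hz := is_derive_zero_on_interval (fun t => d_hor (u t, v t) + lambda) c d t _ hcd Ht
    (is_derive_horo_ratio lambda u v t H6 H7 (Rgt_not_eq _ _ H4)) HD).
  replace (Derive u t * v t - u t * Derive v t)
    with ((Derive u t * v t - u t * Derive v t) / (v t * v t) * (v t * v t)) by (field; lra).
  rewrite Hz; ring. }
assert (Ic : a <= c <= b) by lra; assert (Jc : c <= c <= d) by lra.
destruct (regular_curve_at _ _ _ _ _ Hr Ic) as (?&?&?&?&?&?&?&?&?).
(* Differentiating [u' v - u v' = 0] once more, the mixed terms [u' v'] cancel. *)
assert (HW' : Derive (Derive u) c * v c - u c * Derive (Derive v) c = 0).
{ apply (is_derive_zero_on_interval (fun t => Derive u t * v t - u t * Derive v t) c d c); try assumption.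
  auto_derive; [repeat split; assumption|].
  change (fun x : R => u x) with u; change (fun x : R => v x) with v.
  change (fun x : R => Derive u x) with (Derive u); change (fun x : R => Derive v x) with (Derive v); ring. }
assert (Kc := Hk c Ic (HD c Jc)); apply kappa_h_zero_iff in Kc; [|assumption].
specialize (HW c Jc).
unfold scaled_curvature, speed2 in *.
set (x := u c) in *; set (y := v c) in *; set (p := Derive u c) in *; set (q := Derive v c) in *.
set (p1 := Derive (Derive u) c) in *; set (q1 := Derive (Derive v) c) in *.
(* Velocity and acceleration are both parallel to the position vector, so their determinant
   vanishes. Zero curvature then reduces to [p = 0], and [p y = x q] with [x > 0] gives [q = 0]. *)
assert (E : p * q1 - p1 * q = 0).
{ apply (Rmult_eq_reg_r (x * y)); [|apply Rgt_not_eq, Rmult_lt_0_compat; assumption].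
  replace ((p * q1 - p1 * q) * (x * y)) with (p * y * (x * q1) - x * q * (p1 * y)) by ring.
  replace (p * y) with (x * q) by lra; replace (p1 * y) with (x * q1) by lra; ring. }
rewrite E in Kc; assert (Ep : p = 0) by (unfold Rdiv in Kc; lra).
rewrite Ep in *; assert (Eq : q = 0) by nra.
rewrite Eq in *; lra.
Qed.

Theorem theorem3p7 (lambda a b : R) (hab : a < b) (u v : R -> R)
    (hreg : regular_curve_in_Hplus a b u v) :
  horo_catenary lambda a b u v <->
  (forall t : R, a <= t <= b ->
     kappa_h u v t =
       - ((u t * Derive u t + v t * Derive v t)
          / ((d_hor (u t, v t) + lambda) * v t * sqrt (speed2 u v t)))).
Proof.
rewrite (horo_catenary_iff_defect lambda a b u v hab hreg).
(* Where [d_hor + lambda] is nonzero, the formula is the defect equation divided by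
   [(d_hor + lambda) v sqrt m]. *)
assert (Heq : forall t, a <= t <= b -> d_hor (u t, v t) + lambda <> 0 ->
  horo_defect lambda u v t = 0 <->
  kappa_h u v t = - ((u t * Derive u t + v t * Derive v t)
          / ((d_hor (u t, v t) + lambda) * v t * sqrt (speed2 u v t)))).
{ intros t Ht HD; destruct (regular_curve_at _ _ _ _ _ hreg Ht) as (?&?&?&_).
  unfold horo_defect; rewrite <- kappa_h_sqrt by assumption.
  assert (HS := sqrt_lt_R0 _ H1); set (S := sqrt _) in *.
  split; intros E.
  - replace (u t * Derive u t + v t * Derive v t)
      with (- ((d_hor (u t, v t) + lambda) * (v t * (kappa_h u v t * S)))) by lra.
    field; repeat split; lra.
  - rewrite E; field; repeat split; lra. }
split; intros H.
- intros t Ht; destruct (Req_dec (d_hor (u t, v t) + lambda) 0) as [HD|HD].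
  + rewrite (kappa_h_singular lambda a b u v t hab hreg H Ht HD), HD.
    rewrite !Rmult_0_l; unfold Rdiv; rewrite Rinv_0; ring.
  + apply Heq; auto.
- intros t Ht; apply (horo_defect_zero lambda a b); try assumption.
  + intros x Hx HD; apply Heq; auto.
  (* At a zero of [d_hor + lambda] the formula reads [kappa_h = 0], because [/ 0 = 0]. *)
  + intros x Hx HD; rewrite (H x Hx), HD.
    rewrite !Rmult_0_l; unfold Rdiv; rewrite Rinv_0; ring.
Qed.
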